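(* Let ATM be the formal system described in the context, in which $\hat{L}_1=\theta_1$ is the sentence $\neg\mathbb{T}[L_1]$ and $\hat{L}_2=\theta_2$ is the sentence $\neg\mathbb{A}[L_2]$. Then each of the following four sentences is a theorem of ATM: (a) $\mathbb{M}[L_1] \to \mathbb{A}[\dot{\bot}]$; (b) $\neg\neg\mathbb{M}[L_1]$; (c) $\mathbb{A}[L_2] \to \mathbb{A}[\dot{\bot}]$; (d) $\neg\neg\mathbb{A}[L_2]$.
   Context: The formal system ATM is defined as follows. Terms: $\dot{\bot}$ and $L_1, L_2, L_3,\ldots$ are constant symbols, and each is a term. If $s,t$ are terms, then so are $(s\,\dot{\wedge}\,t)$, $(s\,\dot{\vee}\,t)$, $(s\,\dot{\to}\,t)$, $\dot{\mathbb{A}}[t]$, $\dot{\mathbb{T}}[t]$, $\dot{\mathbb{M}}[t]$. All terms arise this way; there are no variables. Abbreviations: $\dot{\neg}t$ is $t\,\dot{\to}\,\dot{\bot}$, and $s\,\dot{\leftrightarrow}\,t$ is $(s\,\dot{\to}\,t)\,\dot{\wedge}\,(t\,\dot{\to}\,s)$. Sentences: the atomic sentences are $\bot$ and $\mathbb{A}[t]$, $\mathbb{T}[t]$, $\mathbb{M}[t]$ for each term $t$. If $\phi,\psi$ are sentences, so are $(\phi\wedge\psi)$, $(\phi\vee\psi)$, $(\phi\to\psi)$. Abbreviations: $\neg\phi$ is $\phi\to\bot$, and $\phi\leftrightarrow\psi$ is $(\phi\to\psi)\wedge(\psi\to\phi)$. Quotation and evaluation: for a sentence $\phi$, $\dot{\phi}$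 is the term obtained by putting dots on every $\bot,\wedge,\vee,\to,\mathbb{A},\mathbb{T},\mathbb{M}$ in $\phi$. Each term $t$ evaluates to a sentence $\hat{t}$: $\dot{\bot}$ evaluates to $\bot$; $\dot{\mathbb{A}}[t]$, $\dot{\mathbb{T}}[t]$, $\dot{\mathbb{M}}[t]$ evaluate to $\mathbb{A}[t]$, $\mathbb{T}[t]$, $\mathbb{M}[t]$ respectively (with $t$ unchanged); $s\,\dot{\wedge}\,t$, $s\,\dot{\vee}\,t$, $s\,\dot{\to}\,t$ evaluate to $\hat{s}\wedge\hat{t}$, $\hat{s}\vee\hat{t}$, $\hat{s}\to\hat{t}$; and each $L_i$ evaluates to a fixed sentence $\theta_i$, where $\theta_1$ is $\neg\mathbb{T}[L_1]$, $\theta_2$ is $\neg\mathbb{A}[L_2]$, and the remaining $\theta_i$ ($i\ge 3$) are arbitrary fixed sentences. Thus $\hat{\dot{\phi}}=\phi$. Groundedness: the grounded sentences form the smallest set of sentences such that $\bot$ is grounded; $\mathbb{A}[t]$ and $\mathbb{M}[t]$ are grounded for every term $t$; if $\phi,\psi$ are grounded then so are $\phi\wedge\psi$, $\phi\vee\psi$, $\phi\to\psi$; and if $\hat{t}$ is grounded then $\mathbb{T}[t]$ is grounded. Logical axioms: all sentences $(\mathbb{M}[s]\wedge\mathbb{M}[t]\wedge\mathbb{M}[u])\to\mathbb{A}[\dot{A}(s,t,u)]$ for terms $s,t,u$, where $A$ ranges over the standard Hilbert-style axiom schemes of intuitionistic propositional logic and $\dot{A}(s,t,u)$ is the term obtained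 by instantiating the scheme with $s,t,u$ using the dotted connectives (e.g. $s\,\dot{\wedge}\,t\,\dot{\to}\,s$). Nonlogical axioms (for all terms $s,t,t'$): (1) $\mathbb{M}[t]$, whenever $\hat{t}$ is grounded; (2) $(\mathbb{M}[s]\wedge\mathbb{M}[t])\leftrightarrow\mathbb{M}[s\,\dot{\wedge}\,t]\leftrightarrow\mathbb{M}[s\,\dot{\vee}\,t]\leftrightarrow\mathbb{M}[s\,\dot{\to}\,t]$; (3) $\mathbb{A}[t]\to\mathbb{M}[t]$; (4) $(\mathbb{A}[s]\wedge\mathbb{A}[t])\to\mathbb{A}[s\,\dot{\wedge}\,t]$; (5) $(\mathbb{A}[s]\wedge\mathbb{A}[s\,\dot{\to}\,t])\to\mathbb{A}[t]$; (6) $\mathbb{M}[t]\to\mathbb{A}[t\,\dot{\to}\,\dot{\mathbb{A}}[t]]$; (7) $\mathbb{M}[t]\to\mathbb{A}[t\,\dot{\leftrightarrow}\,\dot{\mathbb{T}}[t]]$; (8) $\neg\mathbb{M}[t]\to\mathbb{A}[\dot{\neg}\dot{\mathbb{T}}[t]]$; (9) $\mathbb{M}[t]\to\mathbb{A}[t\,\dot{\leftrightarrow}\,t']$, whenever $\hat{t}=\hat{t}'$. Rules of inference: from $\phi$ and $\psi$ infer $\phi\wedge\psi$; from $\phi$ and $\phi\to\psi$ infer $\psi$ (modus ponens); from $\mathbb{A}[t]$ infer $\hat{t}$ (release). A theorem of ATM is a sentence derivable from the axioms by these rules. *)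

(* Defs.v *)
From Stdlib Require Import PArith.

Declare Scope term_scope.
Delimit Scope term_scope with term.
Declare Scope sentence_scope.
Delimit Scope sentence_scope with sentence.

(* The constructors [tBot], [tAnd], ..., [tM] are the dotted symbols. *)
Inductive term : Type :=
| tBot : term
| tL : positive -> term
| tAnd : term -> term -> term
| tOr : term -> term -> term
| tImp : term -> term -> term
| tA : term -> term
| tT : term -> term
| tM : term -> term.

Inductive sentence : Type :=
| sBot : sentence
| sA : term -> sentence
| sT : term -> sentence
| sM : term -> sentence
| sAnd : sentence -> sentence -> sentence
| sOr : sentence -> sentence -> sentence
| sImp : sentence -> sentence -> sentence.

Bind Scope term_scope with term.
Bind Scope sentence_scope with sentence.

Definition tNot (t : term) : term := tImp t tBot.
Definition tIff (s t : term) : term := tAnd (tImp s t) (tImp t s).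
Definition sNot (p : sentence) : sentence := sImp p sBot.
Definition sIff (p q : sentence) : sentence := sAnd (sImp p q) (sImp q p).

Reserved Notation "¬ x" (at level 75, right associativity).
Reserved Notation "x ∧ y" (at level 80, right associativity).
Reserved Notation "x ∨ y" (at level 85, right associativity).
Reserved Notation "x ⇒ y" (at level 90, right associativity).
Reserved Notation "x ⇔ y" (at level 95, no associativity).

Notation "⊥" := tBot : term_scope.
Notation "¬ x" := (tNot x) : term_scope.
Notation "x ∧ y" := (tAnd x y) : term_scope.
Notation "x ∨ y" := (tOr x y) : term_scope.
Notation "x ⇒ y" := (tImp x y) : term_scope.
Notation "x ⇔ y" := (tIff x y) : term_scope.

Notation "⊥" := sBot : sentence_scope.
Notation "¬ x" := (sNot x) : sentence_scope.
Notation "x ∧ y" := (sAnd x y) : sentence_scope.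
Notation "x ∨ y" := (sOr x y) : sentence_scope.
Notation "x ⇒ y" := (sImp x y) : sentence_scope.
Notation "x ⇔ y" := (sIff x y) : sentence_scope.

Fixpoint quote (p : sentence) : term :=
  match p with
  | sBot => tBot
  | sA t => tA t
  | sT t => tT t
  | sM t => tM t
  | sAnd p q => tAnd (quote p) (quote q)
  | sOr p q => tOr (quote p) (quote q)
  | sImp p q => tImp (quote p) (quote q)
  end.

(* [theta i] is the sentence to which the constant [tL i] evaluates.  The
   arguments of [tA], [tT] and [tM] are left unevaluated. *)
Fixpoint eval (theta : positive -> sentence) (t : term) : sentence :=
  match t with
  | tBot => sBot
  | tL i => theta i
  | tAnd s t => sAnd (eval theta s) (eval theta t)
  | tOr s t => sOr (eval theta s) (eval theta t)
  | tImp s t => sImp (eval theta s) (eval theta t)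
  | tA t => sA t
  | tT t => sT t
  | tM t => sM t
  end.

Lemma eval_quote (theta : positive -> sentence) (p : sentence) :
  eval theta (quote p) = p.
Proof. induction p; simpl; congruence. Qed.

Inductive grounded (theta : positive -> sentence) : sentence -> Prop :=
| grounded_bot : grounded theta ⊥
| grounded_A (t : term) : grounded theta (sA t)
| grounded_M (t : term) : grounded theta (sM t)
| grounded_and (p q : sentence) :
    grounded theta p -> grounded theta q -> grounded theta (p ∧ q)
| grounded_or (p q : sentence) :
    grounded theta p -> grounded theta q -> grounded theta (p ∨ q)
| grounded_imp (p q : sentence) :
    grounded theta p -> grounded theta q -> grounded theta (p ⇒ q)
| grounded_T (t : term) :
    grounded theta (eval theta t) -> grounded theta (sT t).

(* [ipc_instance s t u a]: the term [a] is the instance at [s], [t], [u] of one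
   of the Hilbert-style axiom schemes of intuitionistic propositional logic.
   Schemes with fewer than three metavariables ignore the last ones. *)
Inductive ipc_instance (s t u : term) : term -> Prop :=
| ipc_K : ipc_instance s t u (s ⇒ (t ⇒ s))
| ipc_S : ipc_instance s t u ((s ⇒ (t ⇒ u)) ⇒ ((s ⇒ t) ⇒ (s ⇒ u)))
| ipc_and_l : ipc_instance s t u ((s ∧ t) ⇒ s)
| ipc_and_r : ipc_instance s t u ((s ∧ t) ⇒ t)
| ipc_and_i : ipc_instance s t u (s ⇒ (t ⇒ (s ∧ t)))
| ipc_or_l : ipc_instance s t u (s ⇒ (s ∨ t))
| ipc_or_r : ipc_instance s t u (t ⇒ (s ∨ t))
| ipc_or_e : ipc_instance s t u ((s ⇒ u) ⇒ ((t ⇒ u) ⇒ ((s ∨ t) ⇒ u)))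
| ipc_bot_e : ipc_instance s t u (⊥ ⇒ s).

(* Triple conjunctions are associated to the left, and in [ax_M_connectives] the
   chain of equivalences is read as the conjunction of its consecutive links. *)
Inductive atm_axiom (theta : positive -> sentence) : sentence -> Prop :=
| ax_logical (s t u a : term) :
    ipc_instance s t u a ->
    atm_axiom theta (((sM s ∧ sM t) ∧ sM u) ⇒ sA a)
| ax_M_grounded (t : term) :
    grounded theta (eval theta t) -> atm_axiom theta (sM t)
| ax_M_connectives (s t : term) :
    atm_axiom theta
      ((((sM s ∧ sM t) ⇔ sM (s ∧ t)) ∧
        (sM (s ∧ t) ⇔ sM (s ∨ t))) ∧
       (sM (s ∨ t) ⇔ sM (s ⇒ t)))
| ax_A_M (t : term) : atm_axiom theta (sA t ⇒ sM t)
| ax_A_and (s t : term) : atm_axiom theta ((sA s ∧ sA t) ⇒ sA (s ∧ t))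
| ax_A_imp (s t : term) : atm_axiom theta ((sA s ∧ sA (s ⇒ t)) ⇒ sA t)
| ax_A_A (t : term) : atm_axiom theta (sM t ⇒ sA (t ⇒ tA t))
| ax_A_T (t : term) : atm_axiom theta (sM t ⇒ sA (t ⇔ tT t))
| ax_not_M (t : term) : atm_axiom theta (¬ sM t ⇒ sA (¬ tT t))
| ax_eval_eq (t t' : term) :
    eval theta t = eval theta t' -> atm_axiom theta (sM t ⇒ sA (t ⇔ t')).

Inductive atm_theorem (theta : positive -> sentence) : sentence -> Prop :=
| thm_axiom (p : sentence) : atm_axiom theta p -> atm_theorem theta p
| thm_conj (p q : sentence) :
    atm_theorem theta p -> atm_theorem theta q -> atm_theorem theta (p ∧ q)
| thm_mp (p q : sentence) :
    atm_theorem theta p -> atm_theorem theta (p ⇒ q) -> atm_theorem theta q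
| thm_release (t : term) :
    atm_theorem theta (sA t) -> atm_theorem theta (eval theta t).

(* Main.v *)
(** The nonlogical axioms are built from sentences [A[t]] and [M[t]], which are all
    grounded; releasing the logical axioms at grounded terms yields full
    intuitionistic propositional logic for grounded sentences, so one may reason
    under a grounded hypothesis [h], i.e. with theorems of the form [h ⇒ p].

    Both liar sentences are then handled by the usual arguments carried out inside
    [A].  For (b), if [L_1] is not meaningful then [¬T[L_1]] is assertible by (8),
    hence meaningful, and it evaluates as [L_1] does, so [L_1] is meaningful.  For
    (d), the sentence [¬A[L_2]] is grounded, so releasing (6) gives
    [¬A[L_2] ⇒ A[¬A[L_2]]], whose conclusion yields [A[L_2]]. *)

Require Import Defs.
From Stdlib Require Import PArith.

Local Open Scope sentence_scope.

(* Intuitionistic propositional logic for grounded sentences *)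
Create HintDb grounded.
#[local] Hint Constructors grounded : grounded.

Lemma grounded_not {theta} (p : sentence) : grounded theta p -> grounded theta (¬ p).
Proof. intro hp. now repeat constructor. Qed.

Lemma grounded_iff {theta} (p q : sentence) :
  grounded theta p -> grounded theta q -> grounded theta (p ⇔ q).
Proof. intros hp hq. now repeat constructor. Qed.

#[local] Hint Resolve grounded_not grounded_iff : grounded.

(** Quotations of grounded sentences are meaningful, so the logical axiom asserts [a] and release
    yields its value. Instantiating the scheme at quotations lets evaluation recover [p], [q] and
    [r]. *)
Lemma ipc_release {theta} (p q r : sentence) (a : term) :
  grounded theta p -> grounded theta q -> grounded theta r ->
  ipc_instance (quote p) (quote q) (quote r) a ->
  atm_theorem theta (eval theta a).
Proof.
intros hp hq hr ha.
assert (hM : forall x, grounded theta x -> atm_theorem theta (sM (quote x))).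
{ intros x hx. apply thm_axiom, ax_M_grounded. now rewrite eval_quote. }
apply thm_release.
apply thm_mp with (1 := thm_conj _ _ _ (thm_conj _ _ _ (hM p hp) (hM q hq)) (hM r hr)).
now apply thm_axiom, ax_logical.
Qed.

Ltac release scheme p q r :=
  match goal with |- atm_theorem ?theta _ =>
    let H := fresh in
    assert (H := @ipc_release theta p q r _ ltac:(assumption) ltac:(assumption)
                   ltac:(assumption) (scheme (quote p) (quote q) (quote r)));
    simpl in H; rewrite !eval_quote in H; exact H
  end.

Lemma thm_K {theta} (p q : sentence) : grounded theta p -> grounded theta q ->
  atm_theorem theta (p ⇒ (q ⇒ p)).
Proof. intros; release ipc_K p q q. Qed.

Lemma thm_S {theta} (p q r : sentence) :
  grounded theta p -> grounded theta q -> grounded theta r ->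
  atm_theorem theta ((p ⇒ (q ⇒ r)) ⇒ ((p ⇒ q) ⇒ (p ⇒ r))).
Proof. intros; release ipc_S p q r. Qed.

Lemma thm_and_l {theta} (p q : sentence) : grounded theta p -> grounded theta q ->
  atm_theorem theta ((p ∧ q) ⇒ p).
Proof. intros; release ipc_and_l p q q. Qed.

Lemma thm_and_r {theta} (p q : sentence) : grounded theta p -> grounded theta q ->
  atm_theorem theta ((p ∧ q) ⇒ q).
Proof. intros; release ipc_and_r p q q. Qed.

Lemma thm_and_i {theta} (p q : sentence) : grounded theta p -> grounded theta q ->
  atm_theorem theta (p ⇒ (q ⇒ (p ∧ q))).
Proof. intros; release ipc_and_i p q q. Qed.

Lemma under_weaken {theta} (h p : sentence) : grounded theta h -> grounded theta p ->
  atm_theorem theta p -> atm_theorem theta (h ⇒ p).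
Proof. intros hh hp H. exact (thm_mp _ _ _ H (thm_K p h hp hh)). Qed.

(** With [under_weaken] and [under_id], this stands in for a deduction theorem. *)
Lemma under_mp {theta} (h p q : sentence) :
  grounded theta h -> grounded theta p -> grounded theta q ->
  atm_theorem theta (h ⇒ p) -> atm_theorem theta (h ⇒ (p ⇒ q)) ->
  atm_theorem theta (h ⇒ q).
Proof.
intros hh hp hq Hp Hpq.
exact (thm_mp _ _ _ Hp (thm_mp _ _ _ Hpq (thm_S h p q hh hp hq))).
Qed.

Lemma under_id {theta} (h : sentence) : grounded theta h -> atm_theorem theta (h ⇒ h).
Proof.
intro hh. apply under_mp with (p := h ⇒ h); try apply thm_K; auto with grounded.
Qed.

Lemma imp_trans {theta} (h p q : sentence) :
  grounded theta h -> grounded theta p -> grounded theta q ->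
  atm_theorem theta (p ⇒ q) -> atm_theorem theta (h ⇒ p) -> atm_theorem theta (h ⇒ q).
Proof.
intros hh hp hq Hpq Hp.
apply under_mp with (p := p); auto. apply under_weaken; auto with grounded.
Qed.

Lemma under_and {theta} (h p q : sentence) :
  grounded theta h -> grounded theta p -> grounded theta q ->
  atm_theorem theta (h ⇒ p) -> atm_theorem theta (h ⇒ q) ->
  atm_theorem theta (h ⇒ (p ∧ q)).
Proof.
intros hh hp hq Hp Hq.
apply under_mp with (p := q); auto with grounded.
apply imp_trans with (p := p); auto with grounded. now apply thm_and_i.
Qed.

Lemma thm_and_inv {theta} (p q : sentence) : grounded theta p -> grounded theta q ->
  atm_theorem theta (p ∧ q) -> atm_theorem theta p /\ atm_theorem theta q.
Proof.
intros hp hq H. split; apply (thm_mp _ _ _ H).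
- now apply thm_and_l.
- now apply thm_and_r.
Qed.

(** * Meaningfulness of compound terms *)

Lemma M_connectives {theta} (s t : term) :
  atm_theorem theta ((sM s ∧ sM t) ⇔ sM (s ∧ t)) /\
  atm_theorem theta (sM (s ∧ t) ⇔ sM (s ∨ t)) /\
  atm_theorem theta (sM (s ∨ t) ⇔ sM (s ⇒ t)).
Proof.
assert (H := thm_axiom theta _ (ax_M_connectives theta s t)).
apply thm_and_inv in H as [H H3]; auto 6 with grounded.
apply thm_and_inv in H as [H1 H2]; auto 6 with grounded.
Qed.

Lemma iff_inv {theta} (p q : sentence) : grounded theta p -> grounded theta q ->
  atm_theorem theta (p ⇔ q) -> atm_theorem theta (p ⇒ q) /\ atm_theorem theta (q ⇒ p).
Proof. intros hp hq. apply thm_and_inv; auto with grounded. Qed.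

Lemma under_M_and {theta} (h : sentence) (s t : term) : grounded theta h ->
  atm_theorem theta (h ⇒ sM (s ∧ t)) ->
  atm_theorem theta (h ⇒ sM s) /\ atm_theorem theta (h ⇒ sM t).
Proof.
intros hh H.
assert (Hc : atm_theorem theta (h ⇒ (sM s ∧ sM t))).
{ apply imp_trans with (p := sM (s ∧ t)); auto with grounded.
  apply (iff_inv (sM s ∧ sM t) (sM (s ∧ t))), M_connectives; auto with grounded. }
split; apply imp_trans with (p := sM s ∧ sM t); auto with grounded.
- apply thm_and_l; auto with grounded.
- apply thm_and_r; auto with grounded.
Qed.

Lemma under_M_imp {theta} (h : sentence) (s t : term) : grounded theta h ->
  atm_theorem theta (h ⇒ sM (s ⇒ t)) ->
  atm_theorem theta (h ⇒ sM s) /\ atm_theorem theta (h ⇒ sM t).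
Proof.
intros hh H. apply under_M_and; auto.
apply imp_trans with (p := sM (s ∨ t)); auto with grounded.
{ apply (iff_inv (sM (s ∧ t)) (sM (s ∨ t))), M_connectives; auto with grounded. }
apply imp_trans with (p := sM (s ⇒ t)); auto with grounded.
apply (iff_inv (sM (s ∨ t)) (sM (s ⇒ t))), M_connectives; auto with grounded.
Qed.

Lemma under_M_imp_intro {theta} (h : sentence) (s t : term) : grounded theta h ->
  atm_theorem theta (h ⇒ sM s) -> atm_theorem theta (h ⇒ sM t) ->
  atm_theorem theta (h ⇒ sM (s ⇒ t)).
Proof.
intros hh Hs Ht.
apply imp_trans with (p := sM (s ∨ t)); auto with grounded.
{ apply (iff_inv (sM (s ∨ t)) (sM (s ⇒ t))), M_connectives; auto with grounded. }
apply imp_trans with (p := sM (s ∧ t)); auto with grounded.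
{ apply (iff_inv (sM (s ∧ t)) (sM (s ∨ t))), M_connectives; auto with grounded. }
apply imp_trans with (p := sM s ∧ sM t); auto with grounded.
{ apply (iff_inv (sM s ∧ sM t) (sM (s ∧ t))), M_connectives; auto with grounded. }
apply under_and; auto with grounded.
Qed.

(** * Reasoning inside [A] under a grounded hypothesis *)

Lemma under_A_M {theta} (h : sentence) (t : term) : grounded theta h ->
  atm_theorem theta (h ⇒ sA t) -> atm_theorem theta (h ⇒ sM t).
Proof.
intros hh H. apply imp_trans with (p := sA t); auto with grounded.
apply thm_axiom, ax_A_M.
Qed.

Lemma under_A_mp {theta} (h : sentence) (s t : term) : grounded theta h ->
  atm_theorem theta (h ⇒ sA s) -> atm_theorem theta (h ⇒ sA (s ⇒ t)) ->
  atm_theorem theta (h ⇒ sA t).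
Proof.
intros hh Hs Hst.
apply imp_trans with (p := sA s ∧ sA (s ⇒ t)); auto with grounded.
- apply thm_axiom, ax_A_imp.
- apply under_and; auto with grounded.
Qed.

Lemma under_A_ipc {theta} (h : sentence) (s t u a : term) : grounded theta h ->
  atm_theorem theta (h ⇒ sM s) -> atm_theorem theta (h ⇒ sM t) ->
  atm_theorem theta (h ⇒ sM u) -> ipc_instance s t u a ->
  atm_theorem theta (h ⇒ sA a).
Proof.
intros hh Hs Ht Hu Ha.
apply imp_trans with (p := (sM s ∧ sM t) ∧ sM u); auto with grounded.
- now apply thm_axiom, ax_logical.
- repeat apply under_and; auto with grounded.
Qed.

Lemma under_A_iff {theta} (h : sentence) (s t : term) : grounded theta h ->
  atm_theorem theta (h ⇒ sA (s ⇔ t)) ->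
  atm_theorem theta (h ⇒ sA (s ⇒ t)) /\ atm_theorem theta (h ⇒ sA (t ⇒ s)).
Proof.
intros hh H.
(* The logical axioms need both implications to be meaningful; this follows from the assertibility
   of their conjunction. *)
destruct (under_M_and h _ _ hh (under_A_M h _ hh H)) as [Hl Hr].
split; apply under_A_mp with (s := (s ⇔ t)%term); auto.
- exact (under_A_ipc h _ _ _ _ hh Hl Hr Hr (ipc_and_l _ _ (t ⇒ s)%term)).
- exact (under_A_ipc h _ _ _ _ hh Hl Hr Hr (ipc_and_r _ _ (t ⇒ s)%term)).
Qed.

(** Only [s] has to be known meaningful: the asserted implication from [s] to [t] is meaningful,
    hence so is [t]. This carries meaningfulness and assertibility between a liar constant and the
    term that spells it out. *)
Lemma under_A_eval_eq {theta} (h : sentence) (s t : term) : grounded theta h ->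
  eval theta s = eval theta t -> atm_theorem theta (h ⇒ sM s) ->
  atm_theorem theta (h ⇒ sM t) /\
  atm_theorem theta (h ⇒ sA (s ⇒ t)) /\ atm_theorem theta (h ⇒ sA (t ⇒ s)).
Proof.
intros hh E H.
assert (Hiff : atm_theorem theta (h ⇒ sA (s ⇔ t))).
{ apply imp_trans with (p := sM s); auto with grounded.
  now apply thm_axiom, ax_eval_eq. }
destruct (under_A_iff h _ _ hh Hiff) as [Hl Hr].
split; [| now split].
apply (under_M_imp h s t hh), under_A_M; auto.
Qed.

(** * The liar sentences *)

Lemma M_liar_imp_A_bot (theta : positive -> sentence) (l : term) :
  eval theta l = (¬ sT l)%sentence -> atm_theorem theta (sM l ⇒ sA tBot).
Proof.
intro E.
assert (hh : grounded theta (sM l)) by constructor.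
assert (HM := under_id _ hh).
(* Since [T[l]] is not grounded, the liar argument runs inside [A], with only [M[l]] as outer
   hypothesis. *)
destruct (under_A_iff _ _ _ hh (thm_axiom _ _ (ax_A_T theta l))) as [Hlt Htl].
destruct (under_A_eval_eq (sM l) l (¬ tT l)%term hh E HM) as [HMn [Hln _]].
destruct (under_M_imp _ _ _ hh HMn) as [HMt HMb].
(* [T[l] ⇒ (T[l] ⇒ ⊥)], composed from [T[l] ⇒ l] and [l ⇒ ¬T[l]]. *)
assert (Htn : atm_theorem theta (sM l ⇒ sA (tT l ⇒ ¬ tT l))).
{ apply under_A_mp with (1 := hh) (2 := Htl).
  apply under_A_mp with (s := (tT l ⇒ (l ⇒ ¬ tT l))%term); auto.
  - apply under_A_mp with (1 := hh) (2 := Hln).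
    exact (under_A_ipc _ _ _ _ _ hh (under_A_M _ _ hh Hln) HMt HMt (ipc_K _ _ (tT l))).
  - exact (under_A_ipc _ _ _ _ _ hh HMt HM HMn (ipc_S _ _ _)). }
(* The identity as S K K, inside [A]. *)
assert (Htt : atm_theorem theta (sM l ⇒ sA (tT l ⇒ tT l))).
{ apply under_A_mp with (1 := hh) (s := (tT l ⇒ (tT l ⇒ tT l))%term).
  - exact (under_A_ipc _ _ _ _ _ hh HMt HMt HMt (ipc_K _ _ (tT l))).
  - apply under_A_mp with (1 := hh) (s := (tT l ⇒ ((tT l ⇒ tT l) ⇒ tT l))%term).
    + refine (under_A_ipc _ _ _ _ _ hh HMt _ HMt (ipc_K _ _ (tT l))).
      now apply under_M_imp_intro.
    + refine (under_A_ipc _ _ _ _ _ hh HMt _ HMt (ipc_S _ _ _)).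
      now apply under_M_imp_intro. }
(* Contraction: S merges the two premises [T[l]] of [Htn]. *)
assert (Hn : atm_theorem theta (sM l ⇒ sA (¬ tT l))).
{ apply under_A_mp with (1 := hh) (2 := Htt).
  apply under_A_mp with (1 := hh) (2 := Htn).
  exact (under_A_ipc _ _ _ _ _ hh HMt HMt HMb (ipc_S _ _ _)). }
(* Backwards from the contradiction: [¬T[l]] gives [l] by evaluation, [l] gives [T[l]], and this
   refutes [¬T[l]]. *)
apply under_A_mp with (1 := hh) (3 := Hn).
apply under_A_mp with (1 := hh) (3 := Hlt).
apply under_A_mp with (1 := hh) (2 := Hn).
now apply (under_A_eval_eq (sM l) l).
Qed.

Lemma not_not_M_liar (theta : positive -> sentence) (l : term) :
  eval theta l = (¬ sT l)%sentence -> atm_theorem theta (¬ ¬ sM l).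
Proof.
intro E.
assert (hh : grounded theta (¬ sM l)) by auto with grounded.
apply under_mp with (p := sM l); auto with grounded.
- apply (under_A_eval_eq _ (¬ tT l)%term l hh (eq_sym E)).
  apply under_A_M; auto. apply thm_axiom, ax_not_M.
(* The hypothesis [¬ sM l] is itself the required implication to [⊥]. *)
- now apply under_id.
Qed.

(** Axiom [ax_A_A] puts [A[l]] inside [A], where [l] also yields its negation by evaluation. *)
Lemma A_assertible_liar_imp_A_bot (theta : positive -> sentence) (l : term) :
  eval theta l = (¬ sA l)%sentence -> atm_theorem theta (sA l ⇒ sA tBot).
Proof.
intro E.
assert (hh : grounded theta (sA l)) by constructor.
assert (HA := under_id _ hh).
assert (HM := under_A_M _ _ hh HA).
apply under_A_mp with (s := tA l); auto.
- apply under_A_mp with (1 := hh) (2 := HA).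
  apply imp_trans with (p := sM l); auto with grounded.
  apply thm_axiom, ax_A_A.
- apply under_A_mp with (1 := hh) (2 := HA).
  now apply (under_A_eval_eq (sA l) l (¬ tA l)%term).
Qed.

Lemma not_not_A_assertible_liar (theta : positive -> sentence) (l : term) :
  eval theta l = (¬ sA l)%sentence -> atm_theorem theta (¬ ¬ sA l).
Proof.
intro E.
assert (hh : grounded theta (¬ sA l)) by auto with grounded.
assert (HM : atm_theorem theta (sM (¬ tA l))).
{ now apply thm_axiom, ax_M_grounded. }
assert (Hn : atm_theorem theta (¬ sA l ⇒ sA (¬ tA l))).
(* Evaluation stops at the outer [tA], so the released conclusion still speaks of the term
   [¬ tA l]. *)
{ exact (thm_release _ _ (thm_mp _ _ _ HM (thm_axiom _ _ (ax_A_A _ _)))). }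
apply under_mp with (p := sA l); auto with grounded.
- apply under_A_mp with (1 := hh) (2 := Hn).
  apply (under_A_eval_eq (¬ sA l) (¬ tA l)%term l hh (eq_sym E)).
  now apply under_A_M.
- now apply under_id.
Qed.

Local Close Scope sentence_scope.

Theorem theorem3p1 (theta : positive -> sentence)
  (theta1 : theta 1%positive = (¬ sT (tL 1))%sentence)
  (theta2 : theta 2%positive = (¬ sA (tL 2))%sentence) :
  atm_theorem theta (sM (tL 1) ⇒ sA ⊥) /\
  atm_theorem theta (¬ ¬ sM (tL 1)) /\
  atm_theorem theta (sA (tL 2) ⇒ sA ⊥) /\
  atm_theorem theta (¬ ¬ sA (tL 2)).
Proof.
split; [| split; [| split]].
- now apply M_liar_imp_A_bot.
- now apply not_not_M_liar.
- now apply A_assertible_liar_imp_A_bot.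
- now apply not_not_A_assertible_liar.
Qed.
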